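(* Let $r\ge 1$ and $s\ge 1$ be integers and let $G$ be a graph on $n$ vertices. Then: (1) If $\lambda(\overline{K}_s\vee G)\ge \lambda(\overline{K}_s\vee T_r(n))$, then $\lambda(G)\ge \lambda(T_r(n))$. Moreover, if in addition $\lambda(G)=\lambda(T_r(n))$, then $G\in\mathcal{F}_r(n)$ and $\lambda(\overline{K}_s\vee G)=\lambda(\overline{K}_s\vee T_r(n))$. (2) If $\lambda(\overline{K}_s\vee G)>\lambda(\overline{K}_s\vee T_r(n))$, then $\lambda(G)>\lambda(T_r(n))$. (3) If $\lambda(\overline{K}_s\vee G)=\lambda(\overline{K}_s\vee T_r(n))$ and $\lambda(G)=\lambda(T_r(n))$, then $G\in\mathcal{F}_r(n)$.
   Context: All graphs are finite and simple; $\lambda(\cdot)$ is the spectral radius of the adjacency matrix. $T_r(n)$ is the complete $r$-partite graph on $n$ vertices with part sizes differing by at most one (so $T_1(n)$ is the edgeless graph). $\overline{K}_s$ is the edgeless graph on $s$ vertices, and $G\vee H$ (the join) is the graph obtained from disjoint copies of $G$ and $H$ by adding all edges between them. The family $\mathcal{F}_r(n)$: write $n=ra+b$ with $0\le b<r$ and $a=\lfloor n/r\rfloor$. If $b=0$, $\mathcal{F}_r(n)$ is the set of all $(r-1)a$-regular graphs on $n$ vertices. If $1\le b<r$, $\mathcal{F}_r(n)$ is the set of all graphs $G$ on $n$ vertices having a partition $V(G)=X\sqcup Y$ with $|X|=b(a+1)$, $|Y|=(r-b)a$, such that every vertex of $X$ is adjacent to every vertex of $Y$, $G[X]$ is $(b-1)(a+1)$-regular,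 and $G[Y]$ is $(r-b-1)a$-regular. *)

(* Defs.v *)
From HB Require Import structures.
From mathcomp Require Import all_boot all_order all_algebra algC.
Set Implicit Arguments. Unset Strict Implicit. Unset Printing Implicit Defensive.
Import Order.TTheory GRing.Theory Num.Theory.
Local Open Scope ring_scope.

(* Graphs on n vertices: relations on 'I_n (simplicity assumed as hypotheses). *)

Definition adjmx (n : nat) (e : rel 'I_n) : 'M[algC]_n :=
  \matrix_(i, j) (e i j)%:R.

(* A list of all (complex) eigenvalues with multiplicity: roots of char_poly. *)
Definition eigenvalues (n : nat) (A : 'M[algC]_n) : seq algC :=
  sval (closed_field_poly_normal (char_poly A)).

Definition spectral_radius (n : nat) (A : 'M[algC]_n) : algC :=
  \big[Num.max/0]_(z <- eigenvalues A) `|z|.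

Definition lambda (n : nat) (e : rel 'I_n) : algC := spectral_radius (adjmx e).

Definition join_empty (s n : nat) (e : rel 'I_n) : rel 'I_(s + n) :=
  fun i j => match split i, split j with
             | inr a, inr b => e a b
             | inl _, inl _ => false
             | _, _ => true
             end.

Definition turan (r n : nat) : rel 'I_n := fun i j => (i %% r != j %% r)%N.

Definition deg (n : nat) (e : rel 'I_n) (x : 'I_n) : nat := #|[set y | e x y]|.

Definition in_F (r n : nat) (e : rel 'I_n) : Prop :=
  let a := (n %/ r)%N in let b := (n %% r)%N in
  if b == 0%N then forall x, deg e x = ((r - 1) * a)%N
  else exists X : {set 'I_n},
    [/\ #|X| = (b * (a + 1))%N, #|~: X| = ((r - b) * a)%N,
        (forall x y, x \in X -> y \notin X -> e x y /\ e y x),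
        (forall x, x \in X -> #|[set y in X | e x y]| = ((b - 1) * (a + 1))%N) &
        (forall x, x \notin X -> #|[set y in ~: X | e x y]| = ((r - b - 1) * a)%N)].

Arguments join_empty s {n} e.
Arguments turan : clear implicits.
Arguments in_F r {n} e.
Arguments lambda {n} e.

(* Main.v *)
(* Write n = r a + b. The argument goes through h i := the number of vertices not
   adjacent to i (i included); for the Turan graph, h takes only the values a and
   a + 1 and is constant on the classes of pairwise non-adjacent vertices.  Let
   L be the spectral radius of the Turan graph.

   If lambda G <= L, the Rayleigh quotient of G at the vector 1 / (L + h i) gives
   sum_i 1 / (L + h i) <= 1, while this sum equals 1 for the Turan graph.
   Comparing 1 / (L + k) with its chord through k = a, a + 1 at integers k, one finds
   that either G has fewer edges than the Turan graph, or equality holds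
   throughout; in the latter case lambda G = L and h has the same structure for
   G as for the Turan graph, which puts G in the family F and determines the
   spectral radius of the join.

   If G has fewer edges, let mu be the spectral radius of the Turan join. Since
   1 / (mu - x) <= (mu + x) / (mu^2 - L^2) on [-L, L], the number
   1^T (mu - A)^-1 1 is at most (n mu + 2 e(G)) / (mu^2 - L^2). The average degree
   of the Turan graph is so close to L, namely n L - 2 e(T) < 1, that losing one
   edge makes this smaller than mu / s, so the join of G has spectral radius
   below mu. *)
Require Import Defs.
From mathcomp Require Import all_boot all_order all_algebra algC.
From mathcomp Require Import zify ring lra.
Set Implicit Arguments. Unset Strict Implicit. Unset Printing Implicit Defensive.
Import Order.TTheory GRing.Theory Num.Theory.
Local Open Scope ring_scope.

(** * Eigenvalues, the spectral radius and unitary diagonalization *)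

Lemma mem_eigenvalues n (A : 'M[algC]_n) z :
  (z \in eigenvalues A) = eigenvalue A z.
Proof.
rewrite eigenvalue_root_char /eigenvalues.
case: closed_field_poly_normal => s /= Ds.
by rewrite [in RHS]Ds (monicP (char_poly_monic A)) scale1r root_prod_XsubC.
Qed.

Lemma spectral_radius_ge0 n (A : 'M[algC]_n) : 0 <= spectral_radius A.
Proof.
rewrite /spectral_radius; elim/big_ind: _ => // x y x0 y0.
by rewrite /Num.max; case: ifP.
Qed.

Lemma le_spectral_radius n (A : 'M[algC]_n) z :
  eigenvalue A z -> `|z| <= spectral_radius A.
Proof.
rewrite -mem_eigenvalues /spectral_radius; elim: eigenvalues => // x s IHs.
have m_ge0 : 0 <= \big[Num.max/0]_(w <- s) `|w|.
  by elim/big_ind: _ => // u v u0 v0; rewrite /Num.max; case: ifP.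
rewrite inE big_cons /Num.max.
(* The order of [algC] is partial; the maximum compares well because both arguments are real. *)
case: real_ltP; rewrite ?ger0_real // => cmp /predU1P[->|/IHs] //; first exact: ltW.
by move=> /le_trans; apply.
Qed.

Lemma spectral_radius_attained n (A : 'M[algC]_n) : (0 < n)%N ->
  exists2 z, eigenvalue A z & spectral_radius A = `|z|.
Proof.
move=> n_gt0; have [z0 Az0] := eigenvalue_closed A n_gt0.
have : eigenvalues A != [::].
  by apply: contraTneq Az0 => e0; rewrite -mem_eigenvalues e0.
have -> : (exists2 z, eigenvalue A z & spectral_radius A = `|z|) <->
          (exists2 z, z \in eigenvalues A & spectral_radius A = `|z|).
  by split=> -[z]; [rewrite -mem_eigenvalues|rewrite mem_eigenvalues]; exists z.
rewrite /spectral_radius; elim: eigenvalues => // x s IHs _.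
rewrite big_cons /Num.max; case: ifP => [|_]; last first.
  by exists x; rewrite ?mem_head.
have [->|/IHs [z sz ->]] := eqVneq s [::]; last first.
  by exists z; rewrite // inE sz orbT.
by rewrite big_nil normr_lt0.
Qed.

(** The rows of the unitary matrix [spectralmx] are left eigenvectors, nonzero since the matrix is
    invertible; hence each [D i] is an eigenvalue and is bounded by [lambda e]. *)
Lemma adjmx_spectral n (e : rel 'I_n) : symmetric e ->
  exists (P : 'M[algC]_n) (D : 'I_n -> algC),
  [/\ forall i, D i \is Num.real, forall i, `|D i| <= lambda e,
      forall u v : 'cV_n, \sum_i (u i 0)^* * v i 0 =
                          \sum_i ((P *m u) i 0)^* * (P *m v) i 0
    & forall (u : 'cV_n) i, (P *m (adjmx e *m u)) i 0 = D i * (P *m u) i 0].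
Proof.
move=> e_sym; set A := adjmx e.
have A_herm : A \is hermsymmx.
  apply: realsym_hermsym.
    by apply/eqP; rewrite expr0 scale1r; apply/matrixP=> i j; rewrite !mxE e_sym.
  by apply/mxOverP=> i j; rewrite mxE realn.
have A_real := hermitian_spectral_diag_real A_herm.
have /orthomx_spectralP A_eq := hermitian_normalmx A_herm.
set P := spectralmx A in A_eq; set d := spectral_diag A in A_eq A_real.
have P_unitary : P \is unitarymx := spectral_unitarymx A.
have P_unit := unitarymx_unit P_unitary.
have PA : P *m A = diag_mx d *m P by rewrite {1}A_eq !mulmxA mulmxV // mul1mx.
exists P, (fun i => d 0 i); split.
- by move=> i; apply: (mxOverP A_real).
- move=> i; apply: le_spectral_radius; apply/eigenvalueP; exists (row i P).
    by rewrite -row_mul PA mul_diag_mx; apply/rowP=> j; rewrite !mxE.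
  by apply: contraTneq P_unit => P0; rewrite unitmxE (expand_det_row _ i) big1
    ?unitr0 // => j _; have /rowP/(_ j) := P0; rewrite !mxE => ->; rewrite mul0r.
- move=> u v.
  have H (w z : 'cV[algC]_n) : \sum_i (w i 0)^* * z i 0 = ((map_mx Num.conj w)^T *m z) 0 0.
    by rewrite mxE; apply: eq_bigr => i _; rewrite !mxE.
  have PP : (map_mx Num.conj P)^T *m P = 1%:M.
    by rewrite map_trmx -(invmx_unitary P_unitary) mulVmx.
  by rewrite !H map_mxM trmx_mul -mulmxA (mulmxA _ P) PP mul1mx.
- by move=> u i; rewrite mulmxA PA -mulmxA mul_diag_mx mxE.
Qed.

(** * Quadratic form estimates over the reals *)

(** This is [lambda] viewed in [algR], a totally ordered field, where [lra] and unrestricted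
    comparisons are available. *)
Definition rho n (e : rel 'I_n) : algR :=
  in_algR (ger0_real (spectral_radius_ge0 (adjmx e))).

Definition adj n (e : rel 'I_n) (y : 'I_n -> algR) : 'I_n -> algR :=
  fun i => \sum_j (e i j)%:R * y j.

Lemma rho_ge0 n (e : rel 'I_n) : 0 <= rho e.
Proof. exact: spectral_radius_ge0. Qed.

(* Taking real and imaginary parts of the coordinates in a unitary eigenbasis
   doubles the index set and keeps everything real. *)
Lemma adj_diagonalizable n (e : rel 'I_n) : symmetric e ->
  exists (I : finType) (D : I -> algR) (X : ('I_n -> algR) -> I -> algR),
  [/\ forall k, `|D k| <= rho e,
      forall y z, \sum_i y i * z i = \sum_k X y k * X z k
    & forall y k, X (adj e y) k = D k * X y k].
Proof.
move=> /adjmx_spectral [P [D [D_real D_le PP PA]]].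
pose col (y : 'I_n -> algR) : 'cV[algC]_n := \col_i algRval (y i).
pose x y i : algC := (P *m col y) i 0.
exists ('I_n + 'I_n)%type.
exists (fun k => in_algR (D_real (match k with inl i | inr i => i end))).
exists (fun y k => match k with inl i => in_algR (Creal_Re (x y i))
                           | inr i => in_algR (Creal_Im (x y i)) end).
split=> [[] i|y z|y k]; [exact: D_le|exact: D_le| |].
  rewrite big_sumType /= -big_split /=; apply: val_inj; rewrite -[LHS]/(algRval _) -[RHS]/(algRval _) !rmorph_sum /=.
  have /(congr1 (fun z => 'Re z)) := PP (col y) (col z).
  rewrite (Creal_ReP _ _); last first.
    by apply: rpred_sum => i _; rewrite !mxE rpredM ?conj_Creal ?algRvalP.
  rewrite raddf_sum /=.
  under eq_bigr do rewrite !mxE conj_Creal ?algRvalP //.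
  under [in RHS]eq_bigr => i _.
    rewrite ReM Re_conj Im_conj mulNr opprK -[(P *m col y) i 0]/(x y i)
      -[(P *m col z) i 0]/(x z i); over.
  by move=> <-; apply: eq_bigr => i _.
have xA i : x (adj e y) i = D i * x y i.
  rewrite /x -PA; congr ((P *m _) i 0); apply/colP => l; rewrite !mxE rmorph_sum.
  by apply: eq_bigr => j _; rewrite !mxE rmorphM rmorph_nat.
by case: k => i; apply: val_inj => /=; rewrite xA ?ReMl ?ImMl.
Qed.
Lemma rayleigh n (e : rel 'I_n) (y : 'I_n -> algR) : symmetric e ->
  \sum_i y i * adj e y i <= rho e * \sum_i y i * y i.
Proof.
move=> /adj_diagonalizable [I [D [X [D_le XX XA]]]].
rewrite !XX mulr_sumr; apply: ler_sum => k _; rewrite XA.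
have := D_le k; rewrite ler_norml => /andP[_ ?].
by rewrite mulrCA ler_wpM2r // -expr2 sqr_ge0.
Qed.

(** On an eigenvector with eigenvalue d the two sides differ by a multiple of (rho - d)(rho + d) >=
    0. Consequently a vector attaining the Rayleigh bound is an eigenvector. *)
Lemma adj_defect n (e : rel 'I_n) (y : 'I_n -> algR) : symmetric e ->
  \sum_i (adj e y i - rho e * y i) ^+ 2 <=
  2 * rho e * (rho e * \sum_i y i * y i - \sum_i y i * adj e y i).
Proof.
move=> /adj_diagonalizable [I [D [X [D_le XX XA]]]].
have -> : \sum_i (adj e y i - rho e * y i) ^+ 2 =
    \sum_i adj e y i * adj e y i - 2 * rho e * \sum_i y i * adj e y i
    + rho e ^+ 2 * \sum_i y i * y i.
  rewrite !mulr_sumr -sumrB -big_split; apply: eq_bigr => i _ /=; ring.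
rewrite !XX !mulr_sumr -!sumrB mulr_sumr -big_split; apply: ler_sum => k _ /=.
rewrite !XA; have := D_le k; rewrite ler_norml => /andP[d1 d2].
rewrite -subr_ge0; set d := D k in d1 d2 *; set r := rho e in d1 d2 *; set x := X y k.
have -> : 2 * r * (r * (x * x) - x * (d * x)) - (d * x * (d * x) -
    2 * r * (x * (d * x)) + r ^+ 2 * (x * x)) = x ^+ 2 * ((r - d) * (r + d)).
  by ring.
by rewrite mulr_ge0 ?sqr_ge0 // mulr_ge0; lra.
Qed.

(* On an eigenvector with eigenvalue d this is (mu - d)^-1 <= (mu + d) / (mu^2 - L^2)
   combined with the Cauchy-Schwarz inequality in its quadratic form. *)
Lemma resolvent_bound n (e : rel 'I_n) (y : 'I_n -> algR) (L mu tau : algR) :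
  symmetric e -> rho e <= L -> L < mu ->
  0 <= (mu ^+ 2 - L ^+ 2) * (mu * (\sum_i y i * y i) - \sum_i y i * adj e y i
                             - 2 * tau * \sum_i y i)
       + tau ^+ 2 * (n%:R * mu + \sum_i adj e (fun=> 1) i).
Proof.
move=> /adj_diagonalizable [I [D [X [D_le XX XA]]]] eL Lmu.
(* With the all-ones vector [o] every sum becomes an inner product, so the claim splits over the
   eigenbasis. *)
pose o : 'I_n -> algR := fun=> 1.
have -> : \sum_i y i = \sum_i y i * o i by apply: eq_bigr => i _; rewrite mulr1.
have -> : \sum_i adj e (fun=> 1) i = \sum_i o i * adj e o i.
  by apply: eq_bigr => i _; rewrite mul1r.
have -> : n%:R = \sum_i o i * o i :> algR.
  by under eq_bigr do rewrite mul1r; rewrite sumr_const card_ord.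
rewrite !XX !mulr_sumr -!sumrB mulr_sumr mulr_suml -big_split mulr_sumr -big_split.
apply: sumr_ge0 => k _ /=; rewrite !XA.
have := D_le k; rewrite ler_norml => /andP[d1 d2].
set d := D k in d1 d2 *; set x := X y k; set c := X o k.
have dmu : 0 < mu - d by lra.
have dL : 0 <= (L - d) * (L + d) by apply: mulr_ge0; lra.
have mL : 0 <= (mu - L) * (mu + L) by apply: mulr_ge0; lra.
rewrite -(pmulr_rge0 _ dmu).
have -> : (mu - d) * ((mu ^+ 2 - L ^+ 2) * (mu * (x * x) - x * (d * x) -
    2 * tau * (x * c)) + tau ^+ 2 * (c * c * mu + c * (d * c))) =
  ((mu - L) * (mu + L)) * ((mu - d) * x - tau * c) ^+ 2
    + (tau * c) ^+ 2 * ((L - d) * (L + d)) by ring.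
by rewrite addr_ge0 // mulr_ge0 ?sqr_ge0.
Qed.

(** Take absolute values in an eigenvector of maximal modulus. The triangle inequality gives rho u
    <= A u, so u attains the Rayleigh bound and [adj_defect] applies. *)
Lemma perron n (e : rel 'I_n) : symmetric e -> (0 < n)%N ->
  exists u : 'I_n -> algR, [/\ forall i, 0 <= u i, exists i, 0 < u i
    & forall i, adj e u i = rho e * u i].
Proof.
move=> e_sym n_gt0.
have [z /eigenvalueP [v vA v_nz] rho_z] := spectral_radius_attained (adjmx e) n_gt0.
pose u i : algR := in_algR (normr_real (v 0 i)).
have u_ge0 i : 0 <= u i by rewrite -[_ <= _]/(0 <= `|v 0 i|).
exists u; split=> [//||].
  have /rV0Pn [i vi] := v_nz; exists i.
  by rewrite lt_neqAle u_ge0 andbT eq_sym; apply: contra vi => /eqP/(congr1 val)/normr0_eq0->.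
have u_sub i : rho e * u i <= adj e u i.
  rewrite -[_ <= _]/(algRval _ <= algRval _) rmorphM /= /lambda rho_z -normrM.
  have /rowP/(_ i) := vA; rewrite !mxE => <-; rewrite rmorph_sum.
  apply: le_trans (ler_norm_sum _ _ _) _; apply: ler_sum => j _.
  by rewrite mxE rmorphM rmorph_nat normrM normr_nat mulrC e_sym.
have defect0 : \sum_i (adj e u i - rho e * u i) ^+ 2 = 0.
  apply/eqP; rewrite eq_le; apply/andP; split; last first.
    by apply: sumr_ge0 => i _; rewrite sqr_ge0.
  apply: le_trans (adj_defect _ e_sym) _; rewrite mulr_ge0_le0 //.
    by rewrite mulr_ge0 // rho_ge0.
  rewrite subr_le0 mulr_sumr; apply: ler_sum => i _.
  by rewrite mulrCA ler_wpM2l.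
move=> i; apply/eqP; rewrite -subr_eq0 -sqrf_eq0.
by have /psumr_eq0P/(_ i isT) -> := defect0; rewrite // => j _; rewrite sqr_ge0.
Qed.

(** * The join with an edgeless graph *)

Lemma join_empty_sym s n (e : rel 'I_n) : symmetric e -> symmetric (join_empty s e).
Proof. by move=> e_sym i j; rewrite /join_empty; do 2!case: split => ? //. Qed.

Lemma adj_join_l s n (e : rel 'I_n) u (i : 'I_s) :
  adj (join_empty s e) u (lshift n i) = \sum_j u (rshift s j).
Proof.
rewrite /adj big_split_ord /= big1 => [|j _]; last first.
  by rewrite /join_empty !(unsplitK (inl _)) mul0r.
rewrite add0r; apply: eq_bigr => j _.
by rewrite /join_empty (unsplitK (inl i)) (unsplitK (inr j)) mul1r.
Qed.

Lemma adj_join_r s n (e : rel 'I_n) u (i : 'I_n) :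
  adj (join_empty s e) u (rshift s i) =
  \sum_j u (lshift n j) + adj e (fun j => u (rshift s j)) i.
Proof.
rewrite /adj big_split_ord /=; congr (_ + _); apply: eq_bigr => j _.
  by rewrite /join_empty (unsplitK (inr i)) (unsplitK (inl j)) mul1r.
by rewrite /join_empty !(unsplitK (inr _)).
Qed.

(** The s added vertices have the same neighbours, so a Perron vector takes one value x on them; y
    is its restriction to G. *)
Lemma join_perron s n (e : rel 'I_n) (mu := rho (join_empty s e)) :
  symmetric e -> (0 < s)%N -> (0 < n)%N ->
  exists (x : algR) y, [/\ 0 < mu, 0 < \sum_i y i, mu * x = \sum_i y i
    & forall i, adj e y i + s%:R * x = mu * y i].
Proof.
move=> e_sym s_gt0 n_gt0.
have sn_gt0 : (0 < s + n)%N by rewrite addn_gt0 s_gt0.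
have [u [u_ge0 [k uk] Au]] := perron (@join_empty_sym s _ _ e_sym) sn_gt0.
pose y j := u (rshift s j).
have ul i : mu * u (lshift n i) = \sum_j y j by rewrite -Au adj_join_l.
have ur i : mu * y i = \sum_j u (lshift n j) + adj e y i by rewrite -Au adj_join_r.
have y_gt0 : 0 < \sum_i y i.
  rewrite lt_def; apply/andP; split; last by apply: sumr_ge0 => j _; apply: u_ge0.
  apply: contraTneq uk => y0.
  have {}y0 i : y i = 0 by move/psumr_eq0P: y0 => -> // j _; apply: u_ge0.
  have x0 : \sum_j u (lshift n j) = 0.
    have := ur (Ordinal n_gt0); rewrite y0 mulr0 [adj _ _ _]big1 => [|j _].
      by rewrite addr0 => <-.
    by rewrite y0 mulr0.
  rewrite -leNgt -(splitK k); case: (split k) => i /=; last by rewrite -/(y i) y0.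
  by move/psumr_eq0P: x0 => -> // j _; apply: u_ge0.
pose i0 := Ordinal s_gt0.
have mu_gt0 : 0 < mu.
  rewrite lt_def rho_ge0 andbT; apply: contraTneq y_gt0 => mu0.
  by rewrite -(ul i0) mu0 mul0r ltxx.
exists (u (lshift n i0)), y; split=> // i.
rewrite ur addrC; congr (_ + _).
rewrite (eq_bigr (fun=> u (lshift n i0))) => [|j _]; first by rewrite sumr_const card_ord mulr_natl.
by apply: (mulfI (lt0r_neq0 mu_gt0)); rewrite !ul.
Qed.

(** Let r be the spectral radius of the join and D the degree sum of G. As (r - A) y = s x 1 and r x
    is the sum of y, [resolvent_bound] with tau = s x shows that r >= mu would imply r (mu^2 - L^2)
    <= s (n mu + D), against the hypothesis. *)
Lemma join_rho_lt s n (e : rel 'I_n) (L mu : algR) :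
  symmetric e -> (0 < s)%N -> (0 < n)%N -> rho e <= L -> L < mu ->
  s%:R * (n%:R * mu + \sum_i adj e (fun=> 1) i) < mu * (mu ^+ 2 - L ^+ 2) ->
  rho (join_empty s e) < mu.
Proof.
move=> e_sym s_gt0 n_gt0 eL Lmu; rewrite !ltNge; apply: contra => mu_le.
have [x [y [r_gt0 y_gt0 xE yE]]] := join_perron e_sym s_gt0 n_gt0.
set r := rho (join_empty s e) in mu_le r_gt0 xE yE.
have := resolvent_bound y (s%:R * x) e_sym eL Lmu.
set D := \sum_i adj e (fun=> 1) i; set S := \sum_i y i in xE y_gt0 *.
have -> : \sum_i y i * adj e y i = r * (\sum_i y i * y i) - s%:R * x * S.
  rewrite !mulr_sumr -sumrB; apply: eq_bigr => i _.
  by have := yE i; move/(canRL (addrK _)) => ->; ring.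
have Y_ge0 : 0 <= \sum_i y i * y i by apply: sumr_ge0 => i _; rewrite -expr2 sqr_ge0.
have L_ge0 : 0 <= L := le_trans (rho_ge0 e) eL.
have d_gt0 : 0 < mu ^+ 2 - L ^+ 2 by rewrite subr_sqr mulr_gt0; lra.
have x_gt0 : 0 < x by rewrite -(pmulr_rgt0 _ r_gt0) xE.
have sR : 0 < s%:R :> algR by rewrite ltr0n.
set d := mu ^+ 2 - L ^+ 2 in d_gt0 *; set Y := \sum_i _ in Y_ge0 *; rewrite -xE => h.
(* Adding [h1] to the resolvent bound cancels the terms in the squared norm of y. *)
have h1 : 0 <= d * ((r - mu) * Y) by rewrite (mulr_ge0 (ltW d_gt0)) // mulr_ge0 // subr_ge0.
have h2 : 0 <= s%:R * x ^+ 2 * (s%:R * (n%:R * mu + D) - r * d).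
  by apply: le_trans (addr_ge0 h h1) _; rewrite le_eqVlt; apply/orP; left; apply/eqP; ring.
have {h2}h3 : 0 <= s%:R * (n%:R * mu + D) - r * d.
  by move: h2; rewrite pmulr_rge0 // mulr_gt0 // exprn_gt0.
have : mu * d <= r * d by rewrite ler_wpM2r // ltW.
lra.
Qed.

(** * Counts of non-neighbours and Turan-like graphs *)

Definition nonadj n (e : rel 'I_n) i : nat := #|[set j | ~~ e i j]|.

(** What the equality case yields: non-adjacency need not be transitive. The last clause fixes the
    number of edges, and with the first it makes exactly b (a + 1) vertices have a + 1
    non-neighbours. *)
Definition turan_like r n (e : rel 'I_n) : Prop :=
  [/\ forall i, nonadj e i = (n %/ r)%N \/ nonadj e i = (n %/ r).+1,
      forall i j, ~~ e i j -> nonadj e i = nonadj e j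
    & (\sum_i nonadj e i = n * (n %/ r) + n %% r * (n %/ r).+1)%N].

Lemma nonadj_gt0 n (e : rel 'I_n) i : irreflexive e -> (0 < nonadj e i)%N.
Proof. by move=> e_irr; apply/card_gt0P; exists i; rewrite inE e_irr. Qed.

Lemma nonadjE (R : pzSemiRingType) n (e : rel 'I_n) i :
  (nonadj e i)%:R = \sum_j (~~ e i j)%:R :> R.
Proof.
rewrite -natr_sum /nonadj -sum1_card big_mkcond; congr _%:R.
by apply: eq_bigr => j _; rewrite inE; case: (e i j).
Qed.

Lemma adj_compl n (e : rel 'I_n) y i :
  adj e y i = \sum_j y j - \sum_j (~~ e i j)%:R * y j.
Proof. by rewrite -sumrB; apply: eq_bigr => j _; case: (e i j) => /=; ring. Qed.

Lemma sum_degree n (e : rel 'I_n) :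
  \sum_i adj e (fun=> 1) i = n%:R ^+ 2 - (\sum_i nonadj e i)%:R.
Proof.
rewrite natr_sum (eq_bigr (fun i => n%:R - (nonadj e i)%:R)) => [|i _].
  by rewrite sumrB sumr_const card_ord -[RHS]/(_ - _) expr2 mulr_natr.
rewrite adj_compl sumr_const card_ord nonadjE; congr (_ - _).
by apply: eq_bigr => j _; rewrite mulr1.
Qed.

Lemma degE n (e : rel 'I_n) i : deg e i = (n - nonadj e i)%N.
Proof.
have -> : deg e i = #|~: [set j | ~~ e i j]|.
  by apply: eq_card => j; rewrite !inE negbK.
by rewrite cardsCs setCK card_ord.
Qed.

(* Pairing the eigenvalue equation with the weights (t + nonadj e i)^-1, which
   are constant on the classes of non-adjacent vertices. *)
Lemma turan_like_eigen r n (e : rel 'I_n) (t c : algR) y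
    (a := (n %/ r)%:R : algR) (b := (n %% r)%:R : algR) :
  irreflexive e -> symmetric e -> turan_like r e -> 0 <= t ->
  (forall i, adj e y i + c = t * y i) ->
  (t + a) * (t + a + 1) * \sum_i y i =
  (n%:R * t + (n%:R - b) * (a + 1)) * (\sum_i y i + c).
Proof.
move=> e_irr e_sym [He Hcl Hsum] t_ge0 yE.
pose H i : algR := (nonadj e i)%:R; pose w i := (t + H i)^-1.
have tH i : t + H i != 0.
  by rewrite lt0r_neq0 // ltr_wpDl // ltr0n nonadj_gt0.
(* For h = a or a + 1, dividing (t + a)(t + a + 1) by t + h leaves the other factor, t + 2 a + 1 -
   h, which is linear in h. *)
have wS : (t + a) * (t + a + 1) * \sum_i w i = n%:R * t + (n%:R - b) * (a + 1).
  rewrite mulr_sumr (eq_bigr (fun i => t + 2 * a + 1 - H i)) => [|i _].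
    rewrite sumrB sumr_const card_ord -natr_sum Hsum -addn1 !(natrD, natrM).
    rewrite -/a -/b -mulr_natr; ring.
  apply: (mulIf (tH i)); rewrite mulfVK //.
  have : H i = a \/ H i = a + 1.
    by rewrite /H; case: (He i) => ->; [left | right; rewrite natr1].
  by case=> ->; ring.
suff SE : \sum_i y i = (\sum_i w i) * (\sum_i y i + c) by rewrite [in LHS]SE mulrA wS.
have -> : (\sum_i w i) * (\sum_i y i + c) =
    \sum_i w i * (t * y i) + \sum_i w i * \sum_j (~~ e i j)%:R * y j.
  rewrite -big_split mulr_suml; apply: eq_bigr => i _ /=.
  by rewrite -yE adj_compl -mulrDr; congr (_ * _); ring.
have -> : \sum_i w i * \sum_j (~~ e i j)%:R * y j = \sum_i w i * (H i * y i).
  under eq_bigr do rewrite mulr_sumr; rewrite exchange_big.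
  apply: eq_bigr => j _ /=; rewrite /H nonadjE !mulr_suml mulr_sumr.
  apply: eq_bigr => i _; rewrite e_sym.
  have [|/Hcl eH] := boolP (e j i); first by rewrite !mul0r !mulr0.
  by rewrite /w /H eH.
rewrite -big_split; apply: eq_bigr => i _ /=.
by rewrite -mulrDr -mulrDl mulrA mulVf ?mul1r.
Qed.

(** X consists of the vertices with a + 1 non-neighbours. Non-adjacent vertices lie on the same
    side, so X is completely joined to its complement, and degrees inside a side are its size minus
    [nonadj]. *)
Lemma turan_like_in_F r n (e : rel 'I_n) : (0 < r)%N ->
  irreflexive e -> symmetric e -> turan_like r e -> in_F r e.
Proof.
move=> r_gt0 e_irr e_sym [He Hcl Hsum]; rewrite /in_F.
have nE := divn_eq n r; have b_lt : (n %% r < r)%N by rewrite ltn_mod.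
set a := (n %/ r)%N in He Hsum nE *; set b := (n %% r)%N in Hsum nE b_lt *.
pose X := [set i | nonadj e i == a.+1].
have Xcard : #|X| = (b * a.+1)%N.
  have : (\sum_i nonadj e i = n * a + #|X|)%N.
    rewrite (eq_bigr (fun i => a + (i \in X))%N) => [|i _].
      by rewrite big_split sum_nat_const card_ord -sum1_card [in RHS]big_mkcond.
    by rewrite inE; case: (He i) => ->; lia.
  by lia.
have XCcard : #|~: X| = ((r - b) * a)%N by have := cardsC X; rewrite card_ord; nia.
have card_in (Z : {set _}) x : (forall y, ~~ e x y -> y \in Z) ->
    #|[set y in Z | e x y]| = (#|Z| - nonadj e x)%N.
  move=> xZ; rewrite -(cardsID [set y | e x y] Z).
  have -> : Z :\: [set y | e x y] = [set y | ~~ e x y].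
    by apply/setP => y; rewrite !inE andb_idr // => /xZ.
  by rewrite addnK; apply: eq_card => y; rewrite !inE.
have [b0|b_neq0] := eqVneq b 0%N.
  move=> x; rewrite degE.
  have : x \notin X by rewrite (cards0_eq (A := X)) ?inE // Xcard b0.
  rewrite inE; case: (He x) => ->; rewrite ?eqxx // => _; nia.
exists X; split=> //; rewrite ?addn1 // ?subn1.
- move=> x y xX yX; suff: e x y by rewrite -(e_sym x y) => ->.
  by apply: contraR yX => /Hcl; move: xX; rewrite !inE => /eqP -> <-.
- move=> x xX; rewrite card_in => [|y /Hcl]; last by move: xX; rewrite !inE => /eqP -> <-.
  by move: xX; rewrite inE => /eqP ->; rewrite Xcard; nia.
- move=> x xX; rewrite card_in => [|y /Hcl]; last by move: xX; rewrite !inE => + <-.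
  by move: xX; rewrite inE; case: (He x) => ->; rewrite ?eqxx // => _; rewrite XCcard; nia.
Qed.

Lemma count_residue r n c : (c < r)%N ->
  (\sum_(j < n) (j %% r == c) = n %/ r + (c < n %% r))%N.
Proof.
move=> cr; have r_gt0 : (0 < r)%N by apply: leq_ltn_trans cr.
elim: n => [|n IHn]; first by rewrite big_ord0 div0n mod0n.
rewrite big_ord_recr /= IHn divnS // modnS.
have [/dvdnP[q nq]|_] := boolP (r %| n.+1)%N; last first.
  by rewrite add0n -addnA ltnS [in RHS]leq_eqVlt eq_sym; case: eqVneq => [->|]; rewrite ?ltnn ?addn0.
have -> : (n %% r = r.-1)%N.
  case: q nq => [//|q nq]; have -> : n = (q * r + r.-1)%N by nia.
  by rewrite modnMDl modn_small // prednK.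
by rewrite ltn0 addn0 addnC; case: ltngtP; lia.
Qed.

Lemma turan_nonadj r n (i : 'I_n) : (0 < r)%N ->
  nonadj (turan r n) i = (n %/ r + (i %% r < n %% r))%N.
Proof.
move=> r_gt0; rewrite -count_residue ?ltn_mod // /nonadj -sum1_card big_mkcond.
by apply: eq_bigr => j _; rewrite inE negbK eq_sym; case: eqP.
Qed.

Lemma turan_turan_like r n : (0 < r)%N -> turan_like r (turan r n).
Proof.
move=> r_gt0; split=> [i|i j|].
- by rewrite turan_nonadj //; case: (_ < _)%N; [right|left]; lia.
- by rewrite negbK !turan_nonadj // => /eqP ->.
rewrite (eq_bigr _ (fun i _ => turan_nonadj i r_gt0)) big_split /=.
rewrite sum_nat_const card_ord; congr (_ + _)%N.
(* Only the residues c < b contribute, and each of them occurs a + 1 times. *)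
transitivity (\sum_(i < n) \sum_(c < n %% r) (i %% r == c))%N.
  apply: eq_bigr => i _; have [lt_ib|le_bi] := ltnP.
    rewrite (bigD1 (Ordinal lt_ib)) //= eqxx big1 // => c.
    by rewrite -val_eqE eq_sym /= => /negPf ->.
  by rewrite big1 // => c _; rewrite gtn_eqF // (leq_trans (ltn_ord c)).
rewrite exchange_big /= (eq_bigr (fun=> (n %/ r).+1)) => [|c _].
  by rewrite sum_nat_const card_ord.
rewrite count_residue ?ltn_ord ?addn1 //.
by apply: ltn_trans (ltn_ord c) _; rewrite ltn_mod.
Qed.
(* The test vector w i = (L + nonadj e i)^-1 in the Rayleigh quotient: w A w equals
   (sum w)^2 - sum w + L |w|^2 plus half the sum of the squares
   (w i - w j)^2 over non-adjacent pairs. *)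
Lemma rayleigh_nonadj n (e : rel 'I_n) (L : algR)
    (w := fun i => (L + (nonadj e i)%:R)^-1) :
  irreflexive e -> symmetric e -> 0 <= L ->
  2 * ((\sum_i w i) ^+ 2 - \sum_i w i) +
    \sum_i \sum_j (~~ e i j)%:R * (w i - w j) ^+ 2 <=
  2 * ((rho e - L) * \sum_i w i * w i).
Proof.
move=> e_irr e_sym L_ge0.
have lH i : L + (nonadj e i)%:R != 0.
  by rewrite lt0r_neq0 // ltr_wpDl // ltr0n nonadj_gt0.
have Sw : \sum_i w i = L * (\sum_i w i * w i) + \sum_i (nonadj e i)%:R * (w i * w i).
  rewrite mulr_sumr -big_split; apply: eq_bigr => i _ /=.
  by rewrite -mulrDl mulrA mulfV // mul1r.
have SA : \sum_i w i * adj e w i =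
    (\sum_i w i) ^+ 2 - \sum_i \sum_j (~~ e i j)%:R * (w i * w j).
  rewrite expr2 mulr_suml -sumrB; apply: eq_bigr => i _.
  rewrite adj_compl mulrBr mulr_sumr; congr (_ - _); rewrite mulr_sumr.
  by apply: eq_bigr => j _; rewrite mulrCA.
have SH : \sum_i (nonadj e i)%:R * (w i * w i) =
    \sum_i \sum_j (~~ e i j)%:R * (w i * w i).
  by apply: eq_bigr => i _; rewrite nonadjE mulr_suml.
(* The same sum seen from the other endpoint; together with [SH] it completes the squares (w i - w
   j)^2. *)
have SH' : \sum_i (nonadj e i)%:R * (w i * w i) =
    \sum_i \sum_j (~~ e i j)%:R * (w j * w j).
  rewrite SH exchange_big; apply: eq_bigr => i _; apply: eq_bigr => j _.
  by rewrite e_sym.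
have -> : \sum_i \sum_j (~~ e i j)%:R * (w i - w j) ^+ 2 =
    2 * (\sum_i (nonadj e i)%:R * (w i * w i)) -
    2 * \sum_i \sum_j (~~ e i j)%:R * (w i * w j).
  rewrite [2 * \sum_i (nonadj e i)%:R * _]mulr_natl mulr2n {1}SH SH' -big_split mulr_sumr -sumrB.
  apply: eq_bigr => i _; rewrite -big_split mulr_sumr -sumrB.
  by apply: eq_bigr => j _ /=; ring.
have := rayleigh w e_sym; rewrite SA => h.
rewrite [X in _ ^+ 2 - X]Sw; nra.
Qed.

(* The function k |-> (L + k)^-1 lies above its chord through a and a + 1 at
   every integer k. *)
Lemma chord_integer (R : realFieldType) (L : R) (a k : nat) :
  (0 < k)%N -> 0 <= L ->
  let d := (L + a%:R) * (L + a%:R + 1) * (L + k%:R)^-1 -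
           (L + 2 * a%:R + 1 - k%:R) in
  0 <= d /\ (d = 0 -> k = a \/ k = a.+1).
Proof.
move=> k_gt0 L_ge0 d.
have Lk : 0 < L + k%:R by rewrite ltr_wpDl // ltr0n.
(* No integer lies strictly between a and a + 1, so the numerator below is never negative. *)
have dE : d = (k%:R - a%:R) * (k%:R - a.+1%:R) / (L + k%:R).
  by rewrite /d -[a.+1%:R]natr1; field; rewrite lt0r_neq0.
split=> [|d0].
  rewrite dE divr_ge0 ?(ltW Lk) //; case: (leqP k a) => [ka|ak].
    by rewrite mulr_le0 // subr_le0 ler_nat // ltnW.
  by rewrite mulr_ge0 // subr_ge0 ler_nat // ltnW.
move/eqP: d0; rewrite dE !mulf_eq0 invr_eq0 (gt_eqF Lk) orbF !subr_eq0 !eqr_nat.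
by case/orP=> /eqP; [left|right].
Qed.

(** * The Turan graph on at least two vertices, and comparison with it *)

Section Turan.

Variables (r n : nat).
Hypotheses (r_gt0 : (0 < r)%N) (n_gt1 : (1 < n)%N).

Let a : algR := (n %/ r)%:R.
Let b : algR := (n %% r)%:R.
Let N : algR := n%:R.
Let K : algR := (N - b) * (a + 1).
Let L := rho (turan r n).
(* twice the number of edges of the Turan graph *)
Let M : algR := N ^+ 2 - (N * a + b * (a + 1)).

Lemma turan_irr : irreflexive (turan r n).
Proof. by move=> i; rewrite /turan eqxx. Qed.

Lemma turan_sym : symmetric (turan r n).
Proof. by move=> i j; rewrite /turan eq_sym. Qed.

Lemma turan_sum_nonadj :
  ((n * (n %/ r) + n %% r * (n %/ r).+1)%N)%:R = N * a + b * (a + 1).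
Proof. by rewrite natrD !natrM natr1. Qed.

Lemma NE : N = a * r%:R + b.
Proof. by rewrite /N {1}(divn_eq n r) natrD natrM. Qed.

Lemma N_ge2 : 2 <= N. Proof. by rewrite /N ler_nat. Qed.

Lemma a_cases : a = 0 \/ 1 <= a.
Proof. by rewrite /a; case: (n %/ r)%N => [|k]; [left|right; rewrite ler1n]. Qed.

Lemma b_bounds : 0 <= b /\ b + 1 <= r%:R.
Proof. by split; [rewrite ler0n | rewrite natr1 ler_nat ltn_mod]. Qed.

Lemma turan_like_perron (e : rel 'I_n) :
  irreflexive e -> symmetric e -> turan_like r e ->
  (rho e + a) * (rho e + a + 1) = N * rho e + K.
Proof.
move=> e_irr e_sym eT.
have [u [u_ge0 [k uk] Au]] := perron e_sym (ltnW n_gt1).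
have := @turan_like_eigen r n e (rho e) 0 u e_irr e_sym eT (rho_ge0 e).
move/(_ (fun i => etrans (addr0 _) (Au i))); rewrite addr0; apply: mulIf.
by rewrite lt0r_neq0 // (bigD1 k) //= ltr_wpDr // sumr_ge0.
Qed.

(** Take c = s x in [turan_like_eigen], multiply by mu, and use that mu x is the sum of y to cancel
    that sum. *)
Lemma turan_like_join_perron s (e : rel 'I_n) (mu := rho (join_empty s e)) :
  irreflexive e -> symmetric e -> turan_like r e -> (0 < s)%N ->
  0 < mu /\ mu * (mu + a) * (mu + a + 1) = (N * mu + K) * (mu + s%:R).
Proof.
move=> e_irr e_sym eT s_gt0.
have [x [y [mu_gt0 S_gt0 xE yE]]] := join_perron e_sym s_gt0 (ltnW n_gt1).
split=> //; rewrite -/mu in mu_gt0 xE yE.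
have := turan_like_eigen e_irr e_sym eT (ltW mu_gt0) yE; rewrite -/a -/b -/N -/K.
move: S_gt0 xE; set S := \sum_i y i => S_gt0 xE /(congr1 ( *%R mu)) h.
apply: (mulIf (lt0r_neq0 S_gt0)).
transitivity (mu * ((mu + a) * (mu + a + 1) * S)); first by ring.
by rewrite h -xE; ring.
Qed.

Lemma turan_sum_degree : \sum_i adj (turan r n) (fun=> 1) i = M.
Proof.
have [_ _ Hsum] := turan_turan_like n r_gt0.
by rewrite sum_degree Hsum turan_sum_nonadj.
Qed.

Lemma turan_rho_ge_avg : M <= N * L.
Proof.
have := rayleigh (fun=> 1) turan_sym.
rewrite (eq_bigr (fun i => adj (turan r n) (fun=> 1) i)) => [|i _]; last by rewrite mul1r.
rewrite turan_sum_degree (eq_bigr (fun=> 1)) => [|i _]; last by rewrite mul1r.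
by rewrite sumr_const card_ord mulrC.
Qed.

Lemma turan_rho_quad : (L + a) * (L + a + 1) = N * L + K.
Proof. exact (turan_like_perron turan_irr turan_sym (turan_turan_like n r_gt0)). Qed.

(** For a = 0 the graph is complete on at least two vertices, so its average degree is positive. *)
Lemma turan_rho_pos : 0 < L + a.
Proof.
have L0 : 0 <= L := rho_ge0 _.
case: a_cases => [a0|a1]; last lra.
have := turan_rho_ge_avg; have := NE; have := N_ge2; rewrite /M a0 => N2 Nb h.
have Nb' : N = b by lra.
have : 0 < N * L by apply: lt_le_trans h; rewrite Nb' in N2 *; nra.
by rewrite pmulr_rgt0; lra.
Qed.

(** By the quadratic for L, the number z = N L satisfies z (z - M + K) = N^2 (r - 1)(a^2 + a). If z
    >= M + 1, the left side is at least (M + 1)(K + 1), which exceeds the right side. *)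
Lemma turan_rho_lt_avg : N * L < M + 1.
Proof.
have Q := turan_rho_quad; have L0 : 0 <= L := rho_ge0 _.
have [b0 br] := b_bounds; have N2 := N_ge2; have Nab := NE.
have M0 := turan_rho_ge_avg.
have a2 : a <= a ^+ 2 by case: a_cases => [->|a1]; nra.
have b2 : b <= b ^+ 2.
  by rewrite /b; case: (n %% r)%N => [|k]; rewrite ?expr0n // ler_eXnr // ler1n.
have a0 : 0 <= a by rewrite ler0n.
rewrite ltNge; apply/negP => h.
pose R : algR := r%:R; rewrite -/R in br Nab.
have KE : K = R * (a ^+ 2 + a) by rewrite /K Nab; ring.
have ME : N * (N - 2 * a - 1) = M - K by rewrite /M /K; ring.
have MK : N ^+ 2 * ((R - 1) * (a ^+ 2 + a)) < (M + 1) * (K + 1).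
  (* The left side is at most R^2 a^2 / 2, by b (R - b) <= R^2 / 4 and a <= a^2; on the right, M + K
     is at least R^2 a^2. *)
  have key : b * (R - b) * (a ^+ 2 + a) < M + K + 1.
    have -> : M + K = N ^+ 2 + R * a - 2 * a * b - b by rewrite KE /M Nab; ring.
    have h1 : 4 * (b * (R - b)) <= R ^+ 2 by have := sqr_ge0 (R - 2 * b); lra.
    have h2 : b * (R - b) * (a ^+ 2 + a) <= b * (R - b) * (2 * a ^+ 2).
      by rewrite ler_wpM2l ?mulr_ge0 //; lra.
    have h3 : 4 * (b * (R - b)) * a ^+ 2 <= R ^+ 2 * a ^+ 2 by rewrite ler_wpM2r ?sqr_ge0.
    have h4 : 0 <= 2 * (a * b) * (R - 1) by rewrite !mulr_ge0 //; lra.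
    have h5 : 0 <= R * a by rewrite mulr_ge0.
    have h6 : 0 <= R ^+ 2 * a ^+ 2 by rewrite mulr_ge0 ?sqr_ge0.
    by rewrite Nab; lra.
  have -> : (M + 1) * (K + 1) = N ^+ 2 * ((R - 1) * (a ^+ 2 + a)) +
      (M + K + 1 - b * (R - b) * (a ^+ 2 + a)).
    by rewrite KE /M Nab; ring.
  by rewrite ltrDl subr_gt0.
have M_ge0 : 0 <= M.
  rewrite -turan_sum_degree; apply: sumr_ge0 => i _; apply: sumr_ge0 => j _.
  by rewrite mulr1 ler0n.
have K_ge0 : 0 <= K by rewrite KE mulr_ge0 //; lra.
have : (M + 1) * (K + 1) <= N * L * (N * L - N * (N - 2 * a - 1)).
  by apply: ler_pM; rewrite ?ME; lra.
have -> : N * L * (N * L - N * (N - 2 * a - 1)) =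
    N ^+ 2 * ((L + a) * (L + a + 1) - N * L - (a ^+ 2 + a)) by ring.
rewrite Q => h7; suff : N ^+ 2 * (N * L + K - N * L - (a ^+ 2 + a)) =
  N ^+ 2 * ((R - 1) * (a ^+ 2 + a)) by lra.
by rewrite KE; ring.
Qed.


Lemma K_ge0 : 0 <= K.
Proof.
have [b0 br] := b_bounds; have a0 : 0 <= a by rewrite ler0n.
rewrite /K NE mulr_ge0 //; last lra.
by rewrite addrK mulr_ge0 //; lra.
Qed.

Let P := L - (N - 2 * a - 1).

Lemma conj_root_ge0 : 0 <= P.
Proof.
have N2 := N_ge2; have h := turan_rho_ge_avg; have K0 := K_ge0.
have NP : N * P = (N * L - M) + K by rewrite /P /K /M; ring.
have : 0 <= N * P by rewrite NP; lra.
by rewrite pmulr_rge0; lra.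
Qed.

(* The quadratic satisfied by L has the roots L and - P. *)
Lemma turan_like_join_cubic s (e : rel 'I_n) (mu := rho (join_empty s e)) :
  irreflexive e -> symmetric e -> turan_like r e -> (0 < s)%N ->
  [/\ 0 < mu, L < mu & mu * (mu - L) * (mu + P) = s%:R * (N * mu + K)].
Proof.
move=> e_irr e_sym eT s_gt0.
have [mu_gt0 cubic] := turan_like_join_perron e_irr e_sym eT s_gt0.
rewrite -/mu in mu_gt0 cubic.
have Q := turan_rho_quad; have P0 := conj_root_ge0; have K0 := K_ge0.
have E : mu * (mu - L) * (mu + P) = s%:R * (N * mu + K).
  have -> : mu * (mu - L) * (mu + P) = mu * (mu + a) * (mu + a + 1)
      - mu * (N * mu + K) - mu * ((L + a) * (L + a + 1) - (N * L + K)).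
    by rewrite /P; ring.
  by rewrite cubic Q; ring.
split=> //; rewrite -subr_gt0 -(pmulr_rgt0 _ mu_gt0).
rewrite -(pmulr_lgt0 _ (_ : 0 < mu + P)); last lra.
by rewrite E mulr_gt0 ?ltr0n // ltr_wpDr // mulr_gt0 //; have := N_ge2; lra.
Qed.

(** Divided by the unknown z, the equation reads (z - L)(z + P) = c (N + K / z); beyond L the left
    side increases and the right side does not. *)
Lemma cubic_root_unique (c mu nu : algR) : 0 <= c -> L < mu -> 0 < mu -> mu <= nu ->
  mu * (mu - L) * (mu + P) = c * (N * mu + K) ->
  nu * (nu - L) * (nu + P) = c * (N * nu + K) -> mu = nu.
Proof.
move=> c0 Lmu mu0 le_mn Emu Enu; have P0 := conj_root_ge0; have K0 := K_ge0.
have L0 : 0 <= L := rho_ge0 _.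
have h : mu * nu * ((nu - L) * (nu + P) - (mu - L) * (mu + P)) = c * K * (mu - nu).
  transitivity (mu * (nu * (nu - L) * (nu + P)) - nu * (mu * (mu - L) * (mu + P))).
    by ring.
  by rewrite Emu Enu; ring.
apply/eqP; rewrite eq_le le_mn /= -subr_le0.
have nu0 : 0 < nu by lra.
have pos : 0 < mu * nu * (nu + mu + P - L) by rewrite !mulr_gt0 //; lra.
rewrite -(pmulr_rle0 _ pos).
have -> : mu * nu * (nu + mu + P - L) * (nu - mu) =
  mu * nu * ((nu - L) * (nu + P) - (mu - L) * (mu + P)) by ring.
by rewrite h; apply: mulr_ge0_le0; [apply: mulr_ge0 | rewrite subr_le0].
Qed.

Lemma turan_like_join_rho s (e : rel 'I_n) :
  irreflexive e -> symmetric e -> turan_like r e -> (0 < s)%N ->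
  rho (join_empty s e) = rho (join_empty s (turan r n)).
Proof.
move=> e_irr e_sym eT s_gt0.
have [m0 Lm Em] := turan_like_join_cubic e_irr e_sym eT s_gt0.
have [t0 Lt Et] := turan_like_join_cubic turan_irr turan_sym (turan_turan_like n r_gt0) s_gt0.
case: (leP (rho (join_empty s e)) (rho (join_empty s (turan r n)))) => h.
  exact: cubic_root_unique (ler0n _ s) Lm m0 h Em Et.
by apply/esym; apply: cubic_root_unique (ler0n _ s) Lt t0 (ltW h) Et Em.
Qed.

(** Multiplying the hypothesis of [join_rho_lt] by mu + P and inserting the cubic for mu leaves (N L
    - M)(mu + L) < (N L - D)(mu + P), where D is the degree sum of [e]. *)
Lemma sparse_join_rho_lt s (e : rel 'I_n) :
  symmetric e -> (0 < s)%N -> rho e <= L ->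
  \sum_i adj e (fun=> 1) i <= M - 1 ->
  rho (join_empty s e) < rho (join_empty s (turan r n)).
Proof.
move=> e_sym s_gt0 eL De.
have [] := turan_like_join_cubic turan_irr turan_sym (turan_turan_like n r_gt0) s_gt0.
set mu := rho _ => mu0 Lmu E.
apply: (join_rho_lt e_sym s_gt0 (ltnW n_gt1) eL Lmu).
have P0 := conj_root_ge0; have L0 : 0 <= L := rho_ge0 _.
have lo := turan_rho_ge_avg; have hi := turan_rho_lt_avg.
have muP : 0 < mu + P by lra.
rewrite -(ltr_pM2r muP).
have -> : mu * (mu ^+ 2 - L ^+ 2) * (mu + P) = s%:R * ((N * mu + K) * (mu + L)).
  by transitivity (mu * (mu - L) * (mu + P) * (mu + L)); [ring | rewrite E; ring].
rewrite -mulrA ltr_pM2l ?ltr0n // -/N.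
set D := \sum_i _ in De *.
have -> : (N * mu + K) * (mu + L) =
    N * (mu + L) * (mu + P) - (N * L - M) * (mu + L).
  by rewrite /K /P /M; ring.
have -> : (N * mu + D) * (mu + P) =
    N * (mu + L) * (mu + P) - (N * L - D) * (mu + P) by ring.
rewrite ltrD2l ltrN2.
(* Since N L - M < 1 <= M - D, twice N L - M is less than N L - D; also L < mu and P >= 0. *)
apply: (@le_lt_trans _ _ ((N * L - M) * (2 * mu))).
  by rewrite ler_wpM2l; lra.
apply: (@lt_le_trans _ _ ((N * L - D) * mu)).
  by rewrite mulrA ltr_pM2r //; lra.
by rewrite ler_wpM2l; lra.
Qed.

Lemma sparse_or_turan_like (e : rel 'I_n) :
  irreflexive e -> symmetric e -> rho e <= L ->
  \sum_i adj e (fun=> 1) i <= M - 1 \/ turan_like r e /\ rho e = L.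
Proof.
move=> e_irr e_sym eL; have L0 : 0 <= L := rho_ge0 _.
pose w i := (L + (nonadj e i)%:R)^-1; pose S := \sum_i w i.
have w_gt0 i : 0 < w i by rewrite invr_gt0 ltr_wpDl // ltr0n nonadj_gt0.
pose i0 := Ordinal (ltnW n_gt1).
have S_gt0 : 0 < S by rewrite /S (bigD1 i0) //= ltr_wpDr // sumr_ge0 // => i _; apply: ltW.
have ww_gt0 : 0 < \sum_i w i * w i.
  rewrite (bigD1 i0) //= ltr_wpDr ?mulr_gt0 // sumr_ge0 // => i _.
  by rewrite -expr2 sqr_ge0.
have := rayleigh_nonadj e_irr e_sym L0; rewrite -/w -/S.
have QQ_ge0 : 0 <= \sum_i \sum_j (~~ e i j)%:R * (w i - w j) ^+ 2.
  by apply: sumr_ge0 => i _; apply: sumr_ge0 => j _; rewrite mulr_ge0 ?ler0n ?sqr_ge0.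
set QQ := \sum_i _ in QQ_ge0 *; set W := \sum_i w i * w i in ww_gt0 * => ray.
have rW : (rho e - L) * W <= 0 by rewrite mulr_le0_ge0 ?subr_le0 // ltW.
have S_le1 : S <= 1.
  have : S * (S - 1) <= 0 by rewrite mulrBr mulr1 -expr2; lra.
  by rewrite pmulr_rle0 // subr_le0.
pose d i := (L + a) * (L + a + 1) * w i - (L + 2 * a + 1 - (nonadj e i)%:R).
have dP i := chord_integer (n %/ r) (nonadj_gt0 i e_irr) L0.
have d_ge0 i : 0 <= d i by case: (dP i).
have PQ_gt0 : 0 < (L + a) * (L + a + 1) by have := turan_rho_pos => h; rewrite mulr_gt0 //; lra.
(* By the quadratic for L, the total gap above the chord is a positive multiple of S - 1 plus the
   excess of the non-neighbour count over that of the Turan graph. *)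
have sum_d : \sum_i d i =
    (L + a) * (L + a + 1) * (S - 1) + ((\sum_i nonadj e i)%:R - (N * a + b * (a + 1))).
  rewrite sumrB -mulr_sumr -/S sumrB sumr_const card_ord -natr_sum -mulr_natr.
  by rewrite mulrBr mulr1 {3}turan_rho_quad /K -/N; ring.
have sum_d_ge0 : 0 <= \sum_i d i by apply: sumr_ge0.
have PQS : (L + a) * (L + a + 1) * (S - 1) <= 0 by rewrite pmulr_rle0 // subr_le0.
have : ((n * (n %/ r) + n %% r * (n %/ r).+1)%N)%:R <= (\sum_i nonadj e i)%:R :> algR.
  by rewrite turan_sum_nonadj; lra.
(* The counts are integers, so a strict inequality costs at least one in the degree sum. *)
rewrite ler_nat leq_eqVlt => /predU1P[Heq|]; last first.
  rewrite -(ler_nat algR) -natr1 turan_sum_nonadj sum_degree => h; left.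
  by rewrite /M -/N; lra.
right; move: sum_d; rewrite -Heq turan_sum_nonadj subrr addr0 => sum_d.
(* With equal counts every gap vanishes and S = 1; the Rayleigh estimate then forces [rho e] to
   equal L and [QQ] to vanish, so weights agree on non-adjacent pairs. *)
have d0 : \sum_i d i = 0 by apply/eqP; rewrite eq_le sum_d_ge0 sum_d PQS.
have S1 : S = 1.
  move/eqP: d0; rewrite sum_d mulf_eq0 (gt_eqF PQ_gt0) /= subr_eq0.
  by move/eqP.
rewrite S1 expr1n subrr mulr0 add0r in ray.
split; last first.
  have : 0 <= (rho e - L) * W by lra.
  by rewrite pmulr_lge0 // subr_ge0 => ?; apply/le_anti/andP.
have QQ0 : QQ = 0 by apply/le_anti; rewrite QQ_ge0 andbT; lra.
split=> [i|i j nij|//].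
  by have [_] := dP i; apply; move/psumr_eq0P: d0; apply.
have term_ge0 k l : 0 <= (~~ e k l)%:R * (w k - w l) ^+ 2.
  by rewrite mulr_ge0 ?ler0n ?sqr_ge0.
have QQi : \sum_l (~~ e i l)%:R * (w i - w l) ^+ 2 = 0.
  by move/psumr_eq0P: QQ0 => -> // k _; apply: sumr_ge0 => l _.
move/psumr_eq0P: QQi => /(_ (fun l _ => term_ge0 i l) j isT) /eqP.
by rewrite nij mul1r sqrf_eq0 subr_eq0 (inj_eq invr_inj) (inj_eq (addrI _)) eqr_nat => /eqP.
Qed.

End Turan.

(** * Pointwise equal relations and the final assembly *)

Lemma turan_like_ext r n (e e' : rel 'I_n) : e =2 e' -> turan_like r e' -> turan_like r e.
Proof.
move=> ee'; have ne i : nonadj e i = nonadj e' i.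
  by apply: eq_card => j; rewrite !inE ee'.
by case=> He Hcl Hs; split=> [i|i j|]; rewrite ?(eq_bigr _ (fun i _ => ne i)) ?ne ?ee' //; apply: Hcl.
Qed.

Lemma lambda_ext n (e e' : rel 'I_n) : e =2 e' -> lambda e = lambda e'.
Proof.
move=> ee'; congr spectral_radius; apply/matrixP => i j.
by rewrite !mxE ee'.
Qed.

Theorem theorem1p5 (r s n : nat) (e : rel 'I_n) :
  (1 <= r)%N -> (1 <= s)%N -> irreflexive e -> symmetric e ->
  [/\ (lambda (join_empty s (turan r n)) <= lambda (join_empty s e) ->
         lambda (turan r n) <= lambda e /\
         (lambda e = lambda (turan r n) ->
            in_F r e /\ lambda (join_empty s e) = lambda (join_empty s (turan r n)))),
      (lambda (join_empty s (turan r n)) < lambda (join_empty s e) ->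
         lambda (turan r n) < lambda e) &
      (lambda (join_empty s e) = lambda (join_empty s (turan r n)) ->
         lambda e = lambda (turan r n) -> in_F r e)].
Proof.
move=> r_gt0 s_gt0 e_irr e_sym.
have main : lambda (join_empty s (turan r n)) <= lambda (join_empty s e) ->
    lambda (turan r n) <= lambda e /\
    (lambda e = lambda (turan r n) ->
       in_F r e /\ lambda (join_empty s e) = lambda (join_empty s (turan r n))).
  have [n_gt1|n_le1] := ltnP 1 n; last first.
    (* With at most one vertex there are no edges, so G is the Turan graph itself. *)
    have eT : e =2 turan r n.
      move=> i j; have -> : j = i by apply: val_inj; case: i j => [i ?] [j ?] /=; lia.
      by rewrite e_irr turan_irr.
    move=> _; split=> [|_]; first by rewrite (lambda_ext eT).
    split; last by apply: lambda_ext => i j; rewrite /join_empty; do 2!case: split.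
    by apply: turan_like_in_F => //; apply: turan_like_ext eT _; apply: turan_turan_like.
  move=> joins_le.
  (* The sparse alternative would make the join of G strictly smaller, against [joins_le]. *)
  have eT_like : rho e <= rho (turan r n) -> turan_like r e /\ rho e = rho (turan r n).
    move=> le_rho.
    have [sparse|//] := sparse_or_turan_like r_gt0 n_gt1 e_irr e_sym le_rho.
    have := sparse_join_rho_lt r_gt0 n_gt1 e_sym s_gt0 le_rho sparse.
    by move=> /(le_lt_trans joins_le); rewrite ltxx.
  split=> [|lam_eq].
    have [//|/ltW/eT_like[_ rho_eq]] := leP (rho (turan r n)) (rho e).
    by rewrite -[lambda e]/(algRval (rho e)) rho_eq.
  have [|eT _] := eT_like; first by rewrite -[_ <= _]/(lambda e <= _) lam_eq.
  split; first exact: turan_like_in_F.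
  by have /(congr1 algRval) := turan_like_join_rho r_gt0 n_gt1 e_irr e_sym eT s_gt0.
split=> //.
  move=> lt_joins; have [le_lam lam_eq] := main (ltW lt_joins).
  (* Equal spectral radii of G and the Turan graph would make the joins equal as well. *)
  rewrite lt_def le_lam andbT; apply/eqP => /lam_eq [_ joins_eq].
  by rewrite joins_eq ltxx in lt_joins.
by move=> joins_eq /(proj2 (main _)) []; rewrite ?joins_eq.
Qed.
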